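(* Let $\mathcal{H}=(\mathcal{V},\mathcal{E})$ be a finite graph such that its adjacency matrix $\Delta_{\mathcal{H}}$ has an eigenvalue $E_0\in\sigma(\Delta_{\mathcal{H}})$ of multiplicity at least $l\geq 2$. Suppose there exist orthonormal eigenvectors $\psi_1,\ldots,\psi_l$ of $\Delta_{\mathcal{H}}$ for $E_0$ and vertices $x_1,\ldots,x_m\in\mathcal{V}$, for some $m\geq 1$, satisfying $$\psi_i(x_j)=0\qquad\forall\, 1\leq i\leq l,\ 1\leq j\leq m.$$ Let $G$ be an infinite finitely generated group with generators $g_1,\ldots,g_n$, let $\pi:\{-n,\ldots,-1,1,\ldots,n\}\rightarrow\{1,\ldots,m\}$ be any map, and let $\mathcal{H}_G=(\mathcal{V}_G,\mathcal{E}_G)$ be the Cayley type graph built from $\mathcal{H}$, $G$, the generators $g_1,\ldots,g_n$ and the vertices $v_i=x_{\pi(i)}$, $i\in\{-n,\ldots,-1,1,\ldots,n\}$. Let $H^\omega_G=\Delta_{\mathcal{H}_G}+\sum_{g\in G}\omega_gP_g$ on $\ell^2(\mathcal{H}_G)$, where $\{\omega_g\}_{g\in G}$ are i.i.d. real random variables with an absolutely continuous distribution $\mu$. Then, almost surely, $$E_0+\operatorname{supp}(\mu)\subset\sigma_{pp}(H^\omega_G),$$ and the maximum multiplicity of the point spectrum of $H^\omega_G$ in $E_0+\operatorname{supp}(\mu)$ is at least $l$, i.e. $\sup\{\dim\ker(H^\omega_G-\lambda):\lambda\in E_0+\operatorname{supp}(\mu)\}\geq l$.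
   Context: Graphs are undirected without self-loops (edges are two-element subsets of the vertex set). Given a finitely generated group $G$ with generators $g_1,\ldots,g_n$, a finite undirected graph $\mathcal{H}=(\mathcal{V},\mathcal{E})$ and (not necessarily distinct) vertices $v_{-n},\ldots,v_{-1},v_1,\ldots,v_n\in\mathcal{V}$, the Cayley type graph $\mathcal{H}_G=(\mathcal{V}_G,\mathcal{E}_G)$ has vertex set $\mathcal{V}_G=\mathcal{V}\times G$ and edge set $\mathcal{E}_G$ equal to the union of $$\{\{(v,g),(w,g)\}:\{v,w\}\in\mathcal{E},\ g\in G\}\quad\text{and}\quad\{\{(v_{-i},g),(v_i,gg_i)\}:g\in G,\ 1\leq i\leq n\}.$$ On $\ell^2(\mathcal{H}_G)=\ell^2(\mathcal{V}_G)$ the adjacency operator is $(\Delta_{\mathcal{H}_G}u)((v,h))=\sum_{\{(w,g),(v,h)\}\in\mathcal{E}_G}u((w,g))$, and for $g\in G$, $P_g$ is the projection $(P_gu)((v,h))=u((v,g))$ if $h=g$ and $0$ if $h\neq g$. The operator $H^\omega_G$ is the sum of a bounded self-adjoint operator and a real multiplication operator, taken self-adjoint on the natural (maximal) domain of the multiplication operator. $\sigma_{pp}(H)$ is the pure point spectrum, i.e. the closure of the set of eigenvalues of $H$; $\operatorname{supp}(\mu)$ is the topological support of $\mu$, and $E_0+\operatorname{supp}(\mu)=\{E_0+t:t\in\operatorname{supp}(\mu)\}$. *)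

(* Defs.v *)
From HB Require Import structures.
From mathcomp Require Import all_boot all_order all_algebra.
From mathcomp Require Import all_classical all_reals all_analysis.
From mathcomp Require Import complex.

Set Implicit Arguments.
Unset Strict Implicit.
Unset Printing Implicit Defensive.
Import Order.TTheory GRing.Theory Num.Theory.
Import numFieldNormedType.Exports.

Local Open Scope classical_set_scope.
Local Open Scope ring_scope.

(* A finite simple graph on V is a symmetric irreflexive relation on V.
   This matrix is symmetric, so its left and right eigenspaces correspond. *)
Definition adjacency_mx (R : realType) (V : finType) (edge : rel V) :
    'M[R[i]]_#|V| :=
  \matrix_(i, j) (edge (enum_val i) (enum_val j))%:R.

Definition vec (R : realType) (V : finType) (u : V -> R[i]) : 'cV[R[i]]_#|V| :=
  \col_k u (enum_val k).

Definition orthonormal_family (R : realType) (V : finType) (l : nat)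
    (psi : 'I_l -> V -> R[i]) : Prop :=
  forall i j, \sum_(x : V) psi i x * ((psi j x)^*)%C = (i == j)%:R.

Definition generates (G : groupType) (n : nat) (gen : 'I_n -> G) : Prop :=
  forall S : set G,
    S 1%g -> (forall a b, S a -> S b -> S (a * b)%g) ->
    (forall a, S a -> S a^-1%g) -> (forall i, S (gen i)) ->
    forall a, S a.

(* The index set {-n, .., -1, 1, .., n}: for i : 'I_n, (true, i) stands
   for i + 1 and (false, i) stands for - (i + 1). *)
Definition signed_index (n : nat) : Type := (bool * 'I_n)%type.

(* [cayley_edge edge gen v a b] says that {a, b} is an edge. As edges are
   two-element sets, a pair {(v_{-i}, g), (v_i, g g_i)} that collapses to a
   singleton (g_i = 1 and v_{-i} = v_i) is not an edge. *)
Definition cayley_edge (V : finType) (G : groupType) (n : nat) (edge : rel V)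
    (gen : 'I_n -> G) (v : signed_index n -> V) (a b : V * G) : Prop :=
  a <> b /\
  [\/ edge a.1 b.1 /\ a.2 = b.2,
      exists g i, a = (v (false, i), g) /\ b = (v (true, i), (g * gen i)%g) |
      exists g i, b = (v (false, i), g) /\ a = (v (true, i), (g * gen i)%g)].

(* In a locally finite graph the sum below is finite, whatever u is. *)
Definition adjacency_op (R : realType) (X : choiceType) (E : X -> X -> Prop)
    (u : X -> R[i]) : X -> R[i] :=
  fun x => \sum_(y \in [set y | E y x]) u y.

Definition l2 (R : realType) (X : choiceType) (u : X -> R[i]) : Prop :=
  (\esum_(x in [set: X]) ((Normc.normc (u x)) ^+ 2)%:E < +oo)%E.

Definition fiber_proj (R : realType) (V : finType) (G : groupType) (g : G)
    (u : V * G -> R[i]) : V * G -> R[i] :=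
  fun a => if a.2 == g then u (a.1, g) else 0.

(* The pointwise sum has at most one nonzero term at each vertex. *)
Definition potential (R : realType) (V : finType) (G : groupType)
    (w : G -> R) (u : V * G -> R[i]) : V * G -> R[i] :=
  fun a => \sum_(g \in [set: G]) (w g)%:C%C * fiber_proj g u a.

Definition H_dom (R : realType) (V : finType) (G : groupType)
    (w : G -> R) : set (V * G -> R[i]) :=
  [set u | l2 u /\ l2 (potential w u)].

Definition H_op (R : realType) (V : finType) (G : groupType)
    (E : V * G -> V * G -> Prop) (w : G -> R) (u : V * G -> R[i]) :
    V * G -> R[i] :=
  fun a => adjacency_op E u a + potential w u a.

(* An unbounded operator on functions X -> R[i] is a domain together with an
   action, the latter being relevant on the domain only. *)
Definition op_ker (R : realType) (X : choiceType) (D : set (X -> R[i]))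
    (A : (X -> R[i]) -> X -> R[i]) (z : R[i]) : set (X -> R[i]) :=
  [set u | D u /\ forall x, A u x = z * u x].

Definition is_eigenvalue (R : realType) (X : choiceType) (D : set (X -> R[i]))
    (A : (X -> R[i]) -> X -> R[i]) (z : R[i]) : Prop :=
  exists2 u, op_ker D A z u & exists x, u x != 0.

Definition sigma_pp (R : realType) (X : choiceType) (D : set (X -> R[i]))
    (A : (X -> R[i]) -> X -> R[i]) : set R[i]^o :=
  closure [set z : R[i]^o | is_eigenvalue D A z].

Definition lin_indep (R : realType) (X : choiceType) (k : nat)
    (u : 'I_k -> X -> R[i]) : Prop :=
  forall c : 'I_k -> R[i],
    (forall x, \sum_(i < k) c i * u i x = 0) -> forall i, c i = 0.

(* Dimension over R[i] of a linear subspace, as an extended real in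
   {0, 1, .., +oo}. *)
Definition dimension (R : realType) (X : choiceType) (S : set (X -> R[i])) :
    \bar R :=
  ereal_sup [set k%:R%:E | k in
    [set k | exists u : 'I_k -> X -> R[i],
       (forall i, S (u i)) /\ lin_indep u]].

Definition topological_support (R : realType)
    (mu : probability (measurableTypeR R) R) : set R :=
  [set t | forall U : set R, open U -> U t -> (0 < mu U)%E].

Definition shifted_support (R : realType)
    (mu : probability (measurableTypeR R) R) (E0 : R) : set R :=
  [set E0 + t | t in topological_support mu].

Definition mutually_independent (R : realType) (d : measure_display)
    (T : measurableType d) (P : probability T R) (I : choiceType)
    (X : I -> {RV P >-> R}) : Prop :=
  forall (s : seq I) (B : I -> set R), uniq s ->
    (forall i, measurable (B i)) ->
    P (\bigcap_(i in [set` s]) (X i @^-1` B i)) =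
    (\prod_(i <- s) P (X i @^-1` B i))%E.

Definition has_law (R : realType) (d : measure_display)
    (T : measurableType d) (P : probability T R) (X : {RV P >-> R})
    (mu : probability (measurableTypeR R) R) : Prop :=
  forall B : set R, measurable B -> distribution P X B = mu B.

(* Main.v *)
Require Import Defs.
From HB Require Import structures.
From mathcomp Require Import all_boot all_order all_algebra.
From mathcomp Require Import all_classical all_reals all_analysis.
From mathcomp Require Import complex.

Set Implicit Arguments.
Unset Strict Implicit.
Unset Printing Implicit Defensive.
Import Order.TTheory GRing.Theory Num.Theory.
Import numFieldNormedType.Exports.

Local Open Scope classical_set_scope.
Local Open Scope ring_scope.
(** The operator decouples on a suitable subspace.  The copies V * {g} of the
    finite graph are glued only at the marked vertices, and an eigenvector of
    the finite graph that vanishes there does not notice the gluing.  So,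
    copied to the fibre over g and extended by zero ([on_fiber]), it is an
    eigenvector of the adjacency operator; it also sees the random potential
    as the constant omega_g.  Each E0 + omega_g is therefore an eigenvalue,
    whatever the sample, and its eigenspace contains copies of all the psi_i,
    hence has dimension at least l ([on_fiber_op_ker],
    [orthonormal_lin_indep]).

    Two facts about the sample remain.  Almost surely the values omega_g are
    dense in the support of mu: an open set U of positive mu-measure is missed
    by k of the independent variables with probability (1 - mu U)^k, so it is
    missed by all of them with probability 0, and the countably many intervals
    with rational endpoints suffice to test density ([iid_dense_in_support]).
    As the point spectrum is closed, it contains E0 + supp mu.  Moreover a
    single omega_g lies almost surely in the support, because the complement of
    the support is covered by countably many rational intervals of measure 0
    ([ae_topological_support]); the corresponding eigenvalue E0 + omega_g lies
    in E0 + supp mu and has the required multiplicity. *)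

(** * Eigenvectors carried by one fibre *)

Definition on_fiber (R : realType) (V : finType) (G : groupType)
    (phi : V -> R[i]) (g : G) : V * G -> R[i] :=
  fun a => if a.2 == g then phi a.1 else 0.

Lemma potentialE (R : realType) (V : finType) (G : groupType) (w : G -> R)
    (u : V * G -> R[i]) (a : V * G) :
  potential w u a = (w a.2)%:C%C * u a.
Proof.
rewrite /potential -(@fsbig_widen _ _ _ _ [set a.2]) //.
  by rewrite fsbig_set1 /fiber_proj eqxx; case: a.
move=> h [_ /= ha]; rewrite /fiber_proj ifF ?mulr0 //.
by apply/eqP => e; apply: ha.
Qed.

(** Every edge between two fibres ends at marked vertices, where phi vanishes;
    only the edges inside the fibre of a contribute. *)
Lemma adjacency_op_on_fiber (R : realType) (V : finType) (edge : rel V)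
    (edge_sym : symmetric edge) (edge_irr : irreflexive edge) (G : groupType)
    (n : nat) (gen : 'I_n -> G) (v : signed_index n -> V) (phi : V -> R[i])
    (phi_v : forall k, phi (v k) = 0) (g : G) (a : V * G) :
  adjacency_op (cayley_edge edge gen v) (on_fiber phi g) a =
  on_fiber (fun y => \sum_(z | edge y z) phi z) g a.
Proof.
rewrite /adjacency_op.
pose B := (fun z => (z, a.2)) @` [set z | edge a.1 z].
(* A neighbour outside B is a marked vertex, where the summand vanishes. *)
transitivity (\sum_(y \in B) on_fiber phi g y).
  apply/esym/fsbig_widen => [_ [z az <-]|y [[yNa ya] /= yB]] /=.
    split; last by constructor 1; rewrite edge_sym.
    by move=> za; move: az; rewrite /= -za /= edge_irr.
  rewrite /on_fiber; case: ifP => // _.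
  case: ya => [[e1 e2]|[h [i [-> _]]]|[h [i [_ ->]]]] //=.
  by case: yB; exists y.1; [rewrite /= edge_sym|rewrite -e2; case: y e1 e2 yNa].
rewrite fsbig_image; last by move=> z z' _ _ [].
rewrite -(bigfs _ (r := index_enum V)) ?index_enum_uniq //; last first.
  by move=> z _; rewrite mem_index_enum.
by rewrite /on_fiber /=; case: ifP => // _; rewrite big1.
Qed.

Lemma l2_on_fiber (R : realType) (V : finType) (G : groupType)
    (phi : V -> R[i]) (g : G) : l2 (on_fiber phi g).
Proof.
rewrite /l2; pose B : set (V * G) := (fun z => (z, g)) @` [set: V].
rewrite (esumID B) ?setTI; last first.
  by move=> a _; rewrite lee_fin sqr_ge0.
rewrite [X in (_ + X)%E]esum1 ?adde0; last first.
  move=> [z h] /= zhB; rewrite /on_fiber /= ifF ?Normc.normc0 ?expr0n //.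
  by apply/eqP => e; apply: zhB; exists z; rewrite // e.
have Bfin : finite_set B by apply: finite_image; exact: finite_finset.
rewrite esum_fset //; last by move=> a _; rewrite lee_fin sqr_ge0.
by rewrite fsumEFin // ltry.
Qed.

Lemma on_fiber_op_ker (R : realType) (V : finType) (edge : rel V)
    (edge_sym : symmetric edge) (edge_irr : irreflexive edge) (G : groupType)
    (n : nat) (gen : 'I_n -> G) (v : signed_index n -> V) (phi : V -> R[i])
    (phi_v : forall k, phi (v k) = 0) (E0 : R)
    (phi_eigen : forall y, \sum_(z | edge y z) phi z = E0%:C%C * phi y)
    (w : G -> R) (g : G) :
  op_ker (H_dom w) (H_op (cayley_edge edge gen v) w) (E0 + w g)%:C%C
    (on_fiber phi g).
Proof.
have potE : potential w (on_fiber phi g)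
    = on_fiber (fun y => (w g)%:C%C * phi y) g.
  apply/funext => a; rewrite potentialE /on_fiber.
  by case: eqP => [->|_]; rewrite ?mulr0.
split; first by split; [|rewrite potE]; exact: l2_on_fiber.
move=> a; rewrite /H_op adjacency_op_on_fiber // potE /on_fiber rmorphD.
case: ifP => _; rewrite ?phi_eigen ?mulrDl ?mulr0 ?addr0 //.
Qed.

Lemma adjacency_mx_eigen (R : realType) (V : finType) (edge : rel V)
    (phi : V -> R[i]) (z : R[i]) :
  adjacency_mx R edge *m vec phi = z *: vec phi ->
  forall y, \sum_(y' | edge y y') phi y' = z * phi y.
Proof.
move=> /matrixP eig y; have := eig (enum_rank y) ord0.
rewrite !mxE enum_rankK => <-.
rewrite big_mkcond /=.
rewrite [LHS](reindex_onto (@enum_val _ V) enum_rank) /=; last first.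
  by move=> i _; rewrite enum_rankK.
rewrite [LHS](eq_bigl xpredT) => [|k]; last by rewrite enum_valK eqxx.
apply: eq_bigr => k _; rewrite !mxE enum_rankK.
by case: ifP => _; rewrite ?mul1r ?mul0r.
Qed.

(** The coefficient c_j is recovered from a vanishing combination by pairing
    it with psi_j over one fibre. *)
Lemma orthonormal_lin_indep (R : realType) (V : finType) (G : groupType)
    (l : nat) (psi : 'I_l -> V -> R[i]) (g : G) :
  orthonormal_family psi -> lin_indep (fun i => on_fiber (psi i) g).
Proof.
move=> on c c0 j.
have: \sum_(y : V) (\sum_(i < l) c i * psi i y) * ((psi j y)^*)%C = 0.
  apply: big1 => y _; have := c0 (y, g).
  by rewrite /on_fiber /= eqxx => ->; rewrite mul0r.
under eq_bigr do rewrite mulr_suml.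
rewrite exchange_big /= (bigD1 j) //= [X in _ + X]big1 ?addr0.
  by under eq_bigr do rewrite -mulrA; rewrite -mulr_sumr on eqxx mulr1.
move=> i ij; under eq_bigr do rewrite -mulrA.
by rewrite -mulr_sumr on (negbTE ij) mulr0.
Qed.

(** * Dense visits of an i.i.d. family *)

Lemma ae_forall_countable (d : measure_display) (T : measurableType d)
    (R : realType) (P : {measure set T -> \bar R}) (I : countType)
    (Q : I -> T -> Prop) :
  (forall i, {ae P, forall t, Q i t}) -> {ae P, forall t, forall i, Q i t}.
Proof.
move=> aeQ.
have: {ae P, forall t, forall k : nat,
    if unpickle k is Some i then Q i t else True}.
  apply: ae_foralln => k; case: (unpickle k) => [i|]; first exact: aeQ.
  exact/aeW.
by apply: filterS => t tQ i; have := tQ (pickle i); rewrite pickleK.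
Qed.

(** The event that U is never visited need not be measurable when I is
    uncountable; it is contained in the event F that the variables indexed by
    countably many finite lists, one of each length, all miss U. *)
Lemma iid_hits_ae (R : realType) (d : measure_display) (T : measurableType d)
    (P : probability T R) (mu : probability (measurableTypeR R) R)
    (I : choiceType) (X : I -> {RV P >-> R}) (U : set R) :
  mutually_independent X -> (forall i, has_law (X i) mu) ->
  infinite_set [set: I] -> measurable U -> (0 < mu U)%E ->
  {ae P, forall t, exists i, U (X i t)}.
Proof.
move=> indep law infI mU muU.
have [s sP] : exists s : nat -> seq I, forall k, uniq (s k) /\ size (s k) = k.
  suff /choice [s sP] : forall k, exists r : seq I, uniq r /\ size r = k.
    by exists s.
  move=> k.
  have [B _ kB] := infinite_set_fset k infI.
  exists (take k (finmap.enum_fset B)).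
  by rewrite take_uniq ?finmap.fset_uniq // size_takel.
have mUc : measurable (~` U) by exact: measurableC.
have /fineK muE : mu (~` U) \is a fin_num by exact: fin_num_measure.
set p := fine (mu (~` U)) in muE.
have p_ge0 : 0 <= p by apply: fine_ge0.
have p_lt1 : p < 1.
  by rewrite -lte_fin muE probability_setC // lteBlDr ?fin_num_measure // lteDl.
pose A k := \bigcap_(i in [set` s k]) (X i @^-1` (~` U)).
pose F := \bigcap_k A k.
have mX i : measurable (X i @^-1` (~` U)).
  by rewrite -[_ @^-1` _]setTI; exact: measurable_funP.
have mA k : measurable (A k).
  by apply: fin_bigcap_measurable => //; exact: finite_seq.
have mF : measurable F by apply: bigcapT_measurable.
have PF k : (P F <= (p ^+ k)%:E)%E.
  have -> : (p ^+ k)%:E = P (A k).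
    have [sk_uniq sk_size] := sP k.
    rewrite /A (indep _ (fun=> ~` U)) //.
    rewrite (eq_bigr (fun=> p%:E)) => [|i _]; last first.
      by have := law i _ mUc; rewrite /distribution /pushforward /= muE.
    by rewrite prodEFin big_const_seq count_predT iter_mulr_1 sk_size.
  by apply: le_measure; rewrite ?inE // => t; exact.
exists F; split => //.
  apply/eqP; rewrite eq_le measure_ge0 andbT.
  have : fine (P F) <= 0.
    have p_cvg : (GRing.exp p : R ^nat) @ \oo --> 0.
      by apply: cvg_expr; rewrite ger0_norm.
    apply: (cvgr_to_ge p_cvg).
    apply: nearW => k; rewrite -lee_fin fineK ?PF //.
    exact: fin_num_measure.
  by rewrite -lee_fin fineK //; exact: fin_num_measure.
by move=> t tU k _ i _ Ut; apply: tU; exists i.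
Qed.

Definition rat_itv (R : realType) (q : rat * rat) : set R :=
  `]ratr q.1, ratr q.2[%classic.

Lemma nbhs_rat_itv (R : realType) (x : R) (U : set R) :
  nbhs x U -> exists q : rat * rat, rat_itv q x /\ rat_itv q `<=` U.
Proof.
move=> /nbhs_ballP [e /= e0 eU].
have [a] := @rat_in_itvoo R (x - e) x ltac:(by rewrite ltrBlDr ltrDl).
have [b] := @rat_in_itvoo R x (x + e) ltac:(by rewrite ltrDl).
rewrite !in_itv /= => /andP [xb be] /andP [ea ax].
exists (a, b); split; rewrite /rat_itv /= ?in_itv /= ?ax //.
move=> y /=; rewrite in_itv /= => /andP [ay yb]; apply: eU.
rewrite /ball /= ltr_distlC; apply/andP.
by split; [apply: lt_trans ay | apply: lt_trans be].
Qed.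

(** The complement of the support is covered by the rational intervals of
    measure 0; they are countably many, and X almost surely avoids each. *)
Lemma ae_topological_support (R : realType) (d : measure_display)
    (T : measurableType d) (P : probability T R)
    (mu : probability (measurableTypeR R) R) (X : {RV P >-> R}) :
  has_law X mu -> {ae P, forall t, topological_support mu (X t)}.
Proof.
move=> law.
have : {ae P, forall t, forall q : rat * rat,
    mu (rat_itv q) = 0%E -> ~ rat_itv q (X t)}.
  apply: ae_forall_countable => q.
  have [q0|qN0] := eqVneq (mu (rat_itv q)) 0%E; last first.
    by apply: aeW => t q0; move/eqP: qN0.
  exists (X @^-1` rat_itv q); split.
  - rewrite -[_ @^-1` _]setTI; apply: measurable_funP => //.
    exact: measurable_itv.
  - by rewrite -[RHS]q0 -law; [|exact: measurable_itv].
  - by move=> t /= tq; apply: contrapT => tN; apply: tq => _.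
apply: filterS => t tq U Uopen Ut.
have [q [qt qU]] := nbhs_rat_itv (open_nbhs_nbhs (conj Uopen Ut)).
rewrite lt0e measure_ge0 andbT; apply/eqP => U0.
apply: (tq q) => //; apply/eqP; rewrite eq_le measure_ge0 andbT -U0.
apply: le_measure => //; rewrite inE; first exact: measurable_itv.
exact: measurable_realfun.open_measurable.
Qed.
Lemma iid_dense_in_support (R : realType) (d : measure_display)
    (T : measurableType d) (P : probability T R)
    (mu : probability (measurableTypeR R) R)
    (I : choiceType) (X : I -> {RV P >-> R}) :
  mutually_independent X -> (forall i, has_law (X i) mu) ->
  infinite_set [set: I] ->
  {ae P, forall t,
    topological_support mu `<=` closure (range (fun i => X i t))}.
Proof.
move=> indep law infI.
have hits : {ae P, forall t, forall q : rat * rat,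
    (0 < mu (rat_itv q))%E -> exists i, rat_itv q (X i t)}.
  apply: ae_forall_countable => q.
  have [q_gt0|qN] := boolP (0 < mu (rat_itv q))%E; last exact: aeW.
  apply: filterS (iid_hits_ae indep law infI _ q_gt0) => //.
  exact: measurable_itv.
apply: filterS hits => t t_hits s s_supp B B_nbhs.
have [q [qs qB]] := nbhs_rat_itv B_nbhs.
have [|i qi] := t_hits q; first by apply: s_supp; first exact: itv_open.
by exists (X i t); split; [exists i | exact: qB].
Qed.

(** * The point spectrum *)

(** An element of R[i] that is positive for the order has zero imaginary part,
    so a complex ball with real centre cuts a real ball out of R. *)
Lemma nbhs_real_complex (R : realType) (E : R) (B : set R[i]^o) :
  nbhs (E%:C%C : R[i]^o) B -> nbhs E [set y : R | B y%:C%C].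
Proof.
move=> /nbhs_ballP [[e1 e2] /= ].
rewrite ltcE /= => /andP [/eqP -> e1_gt0] eB.
apply/nbhs_ballP; exists e1 => //= y Ey; apply: eB.
move: Ey; rewrite /ball /= => Ey.
by rewrite -rmorphB /= normc_def /= expr0n addr0 sqrtr_sqr ltcR.
Qed.
Theorem theorem3p3 (R : realType)
  (V : finType) (edge : rel V)
  (edge_sym : symmetric edge) (edge_irr : irreflexive edge)
  (E0 : R) (l : nat) (l_ge2 : (2 <= l)%N)
  (E0_mult : (l <= \rank (eigenspace (adjacency_mx R edge) E0%:C%C))%N)
  (psi : 'I_l -> V -> R[i])
  (psi_orthonormal : orthonormal_family psi)
  (psi_eigen : forall i,
     adjacency_mx R edge *m vec (psi i) = E0%:C%C *: vec (psi i))
  (m : nat) (m_ge1 : (1 <= m)%N) (x : 'I_m -> V)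
  (psi_x : forall i j, psi i (x j) = 0)
  (G : groupType) (G_infinite : infinite_set [set: G])
  (n : nat) (gen : 'I_n -> G) (gen_G : generates gen)
  (pi_ : signed_index n -> 'I_m)
  (mu : probability (measurableTypeR R) R)
  (mu_ac : mu `<< @lebesgue_measure R)
  (d : measure_display) (T : measurableType d) (P : probability T R)
  (omega : G -> {RV P >-> R})
  (omega_indep : mutually_independent omega)
  (omega_law : forall g, has_law (omega g) mu) :
  let EG := cayley_edge edge gen (fun k => x (pi_ k)) in
  {ae P, forall t : T,
    let w := fun g : G => omega g t in
    [set E%:C%C | E in shifted_support mu E0]
      `<=` sigma_pp (H_dom w) (H_op EG w) /\
    (l%:R%:E <=
      ereal_sup [set dimension (op_ker (H_dom w) (H_op EG w) E%:C%C)
                | E in shifted_support mu E0])%E }.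
Proof.
have psi_eq i := adjacency_mx_eigen (psi_eigen i).
have in_ker (w : G -> R) g i : op_ker (H_dom w)
    (H_op (cayley_edge edge gen (fun k => x (pi_ k))) w) (E0 + w g)%:C%C
    (on_fiber (psi i) g).
  by apply: on_fiber_op_ker => // k; exact: psi_x.
have [g0 _] : [set: G] !=set0 by exact: infinite_setN0.
have l_gt0 : (0 < l)%N by exact: ltn_trans l_ge2.
move=> EG.
have dense := iid_dense_in_support omega_indep omega_law G_infinite.
have supp0 := ae_topological_support (omega_law g0).
apply: filterS2 dense supp0 => t t_dense t_supp; pose w g := omega g t; split.
  move=> _ [_ [s s_supp <-] <-] B /nbhs_real_complex /= B_nbhs.
  have B_nbhs_s : nbhs s [set y : R | B (E0 + y)%:C%C].
    have shift_cont : {for s, continuous (fun y : R => E0 + y)}.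
      by apply: cvgD; [exact: cvg_cst | exact: cvg_id].
    exact: shift_cont B_nbhs.
  have [_ [[g _ <-] Bg]] := t_dense _ s_supp _ B_nbhs_s.
  exists (E0 + w g)%:C%C; split; last exact: Bg.
  exists (on_fiber (psi (Ordinal l_gt0)) g); first exact: in_ker.
  (* A function vanishing on the fibre would have norm 0 instead of 1. *)
  apply: contrapT => phi0.
  suff : \sum_(y : V) psi (Ordinal l_gt0) y * ((psi (Ordinal l_gt0) y)^*)%C = 0.
    by rewrite psi_orthonormal eqxx => /eqP; rewrite oner_eq0.
  apply: big1 => y _; rewrite [psi _ y](_ : _ = 0) ?mul0r //; apply/eqP.
  apply: contrapT => /negP yN0; apply: phi0; exists (y, g).
  by rewrite /on_fiber eqxx.
apply: (@le_trans _ _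
  (dimension (op_ker (H_dom w) (H_op EG w) (E0 + w g0)%:C%C))).
  apply: ereal_sup_ubound; exists l => //.
  exists (fun i => on_fiber (psi i) g0); split; first exact: in_ker.
  exact: orthonormal_lin_indep.
apply: ereal_sup_ubound; exists (E0 + w g0) => //.
by exists (w g0).
Qed.
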